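(* Let $\lambda=(\lambda_1\ge\cdots\ge\lambda_r>0)$ and $\mu=(\mu_1\ge\cdots\ge\mu_r\ge0)$ be partitions with $\mu_i\le\lambda_i$ for all $i$, and let $f=(f_1,\dots,f_r)$, $g=(g_1,\dots,g_r)$ be sequences of positive integers such that $f/g$ is a flagging of the skew shape $\lambda/\mu$. Then $$\widetilde{G}_{\lambda/\mu,f/g}(x)=G_{\lambda/\mu,f/g}(x).$$
   Context: Let $\lambda=(\lambda_1\ge\cdots\ge\lambda_r>0)$, $\mu=(\mu_1\ge\cdots\ge\mu_r\ge0)$ with $\mu_i\le\lambda_i$ for all $i$. The skew shape $\lambda/\mu$ is $\{(i,j):1\le i\le r,\ \mu_i<j\le\lambda_i\}$ (English notation, $i$ is the row). Given sequences of positive integers $f=(f_1,\dots,f_r)$, $g=(g_1,\dots,g_r)$, one says $f/g$ is a flagging of $\lambda/\mu$ if $g_i\le g_{i+1}$ and $f_i\le f_{i+1}$ whenever $\mu_i<\lambda_{i+1}$. $FSVT(\lambda/\mu,f/g)$ is the set of fillings $T$ of the boxes of $\lambda/\mu$ in which each box of row $i$ is filled with a non-empty subset of $\{g_i,g_i+1,\dots,f_i\}$, such that the maximum at $(i,j)$ is at most the minimum at $(i,j+1)$ whenever both boxes lie in $\lambda/\mu$, and strictly less than the minimum at $(i+1,j)$ whenever both boxes lie in $\lambda/\mu$. Define $$G_{\lambda/\mu,f/g}(x)=\sum_{T\in FSVT(\lambda/\mu,f/g)}\beta^{|T|-|\lambda/\mu|}\prod_{k\in T}x_k,$$ where $|T|$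 is the total number of entries of $T$, $|\lambda/\mu|$ the number of boxes, and the product is over all entries of $T$ (with multiplicity). For positive integers $p,q$ and $m\in\mathbb{Z}$, $G_m^{[p/q]}=G_m^{[p/q]}(x)\in\mathbb{Z}[\beta][[x]]$, $x=(x_1,x_2,\dots)$, is defined by $$\sum_{m\in\mathbb{Z}}G_m^{[p/q]}u^m=\frac{1}{1+\beta u^{-1}}\prod_{q\le i\le p}\frac{1+\beta x_i}{1-x_iu},$$ where $\frac1{1+\beta u^{-1}}$ is expanded in powers of $u^{-1}$, $\frac1{1-x_iu}$ in powers of $u$, and the product is $1$ if $q>p$. Define $$\widetilde{G}_{\lambda/\mu,f/g}(x)=\det\left(\sum_{s\ge0}\binom{i-j}{s}\beta^sG^{[f_i/g_j]}_{\lambda_i-\mu_j+j-i+s}\right)_{1\le i,j\le r},$$ with $\binom{n}{s}=n(n-1)\cdots(n-s+1)/s!$ for $n\in\mathbb{Z}$, $s\ge0$. *)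

(* Defs.v *)
From HB Require Import structures.
From mathcomp Require Import all_boot all_order all_algebra finmap.
From mathcomp Require Import boolp classical_sets functions cardinality fsbigop.
From mathcomp Require Import monalg.

Set Implicit Arguments.
Unset Strict Implicit.
Unset Printing Implicit Defensive.

Import GRing.Theory.
Local Open Scope ring_scope.

(* Formal power series over R in commuting variables indexed by an arbitrary
   (possibly infinite) choiceType I: a coefficient for every monomial. *)
Record fps (I : choiceType) (R : Type) : Type := FPS {
  fcoef : {cmonom I} -> R
}.

Section Fps.
Context {I : choiceType} {R : comNzRingType}.
Implicit Types (f g h : fps I R) (m : {cmonom I}).

HB.instance Definition _ := gen_eqMixin (fps I R).
HB.instance Definition _ := gen_choiceMixin (fps I R).

Lemma fpsP f g : (forall m, fcoef f m = fcoef g m) <-> f = g.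
Proof.
case: f g => [f] [g]; split=> [fg|->//].
by congr FPS; apply/funext.
Qed.

Definition msplit m : set ({cmonom I} * {cmonom I}) :=
  [set k | mmul k.1 k.2 = m]%classic.

Lemma finite_msplit m : finite_set (msplit m).
Proof.
pose F := {ffun finsupp m -> 'I_(\max_(i : finsupp m) m (val i)).+1}.
pose d (phi : F) : {cmonom I} :=
  mkcmonom [fsfun i : finsupp m => (phi i : nat) | 0%N].
have fin : finite_set ((fun phi => (d phi, divcm m (d phi))) @` [set: F])%classic.
  exact/finite_image/finite_finset.
apply: sub_finite_set fin => -[a b] /= abm.
have le i : (a i <= m i)%N by rewrite -abm cmM leq_addr.
pose phi : F := [ffun i => inord (a (val i))].
have dE : d phi = a.
  apply/eqP/cmP => i; rewrite cmE fsfun_ffun; case: insubP => [u _ ui|ni].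
    rewrite /= ffunE inordK ?ui // ltnS -ui.
    by apply: leq_trans (le _) _; apply: (leq_bigmax (F := fun i : finsupp m => m (val i)) u).
  by have := le i; rewrite (fsfun_dflt ni) leqn0 => /eqP ->.
exists phi => //; rewrite dE; congr pair; apply/eqP/cmP => i.
by rewrite divcmE -abm cmM addKn.
Qed.

Definition fps0 : fps I R := FPS (fun=> 0).
Definition fps_opp f : fps I R := FPS (fun m => - fcoef f m).
Definition fps_add f g : fps I R := FPS (fun m => fcoef f m + fcoef g m).

Definition fpsC (c : R) : fps I R := FPS (fun m => if m == mone then c else 0).
Definition fpsX (i : I) : fps I R := FPS (fun m => (m == ucm i)%:R).

Definition fps_mul f g : fps I R :=
  FPS (fun m => \sum_(k \in msplit m) fcoef f k.1 * fcoef g k.2).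

Lemma fps_addA : associative fps_add.
Proof. by move=> f g h; apply/fpsP=> m /=; rewrite addrA. Qed.

Lemma fps_addC : commutative fps_add.
Proof. by move=> f g; apply/fpsP=> m /=; rewrite addrC. Qed.

Lemma fps_add0 : left_id fps0 fps_add.
Proof. by move=> f; apply/fpsP=> m /=; rewrite add0r. Qed.

Lemma fps_addN : left_inverse fps0 fps_opp fps_add.
Proof. by move=> f; apply/fpsP=> m /=; rewrite addNr. Qed.

HB.instance Definition _ := GRing.isZmodule.Build (fps I R)
  fps_addA fps_addC fps_add0 fps_addN.

Local Definition splits m : seq ({cmonom I} * {cmonom I}) := fset_set (msplit m).

Local Lemma splits_uniq m : uniq (splits m).
Proof. exact: fset_uniq. Qed.
#[local] Hint Resolve splits_uniq : core.

Local Lemma mem_splits m k : (k \in splits m) = (mmul k.1 k.2 == m).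
Proof.
rewrite /splits in_fset_set; last exact: finite_msplit.
by apply/idP/eqP; rewrite inE.
Qed.

Local Lemma fps_mulE f g m :
  fcoef (fps_mul f g) m = \sum_(k <- splits m) fcoef f k.1 * fcoef g k.2.
Proof. by rewrite /= fsbig_finite //; exact: finite_msplit. Qed.

Lemma fps_mulC : commutative fps_mul.
Proof.
move=> f g; apply/fpsP=> m; rewrite !fps_mulE.
rewrite [RHS](perm_big [seq (k.2, k.1) | k <- splits m]) /=.
  by rewrite big_map; apply: eq_bigr => k _; rewrite mulrC.
apply: uniq_perm => //.
  by rewrite map_inj_uniq // => -[a b] [a' b'] [-> ->].
move=> [a b]; rewrite mem_splits /=; apply/idP/mapP => [abm|[[a' b']]].
  by exists (b, a); rewrite ?mem_splits //= mulmC.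
by rewrite mem_splits /= mulmC => abm [-> ->].
Qed.

Lemma fps_mulA : associative fps_mul.
Proof.
move=> f g h; apply/fpsP=> m; rewrite !fps_mulE.
pose F (t : {cmonom I} * ({cmonom I} * {cmonom I})) :=
  fcoef f t.1 * (fcoef g t.2.1 * fcoef h t.2.2).
pose r1 : seq ({cmonom I} * ({cmonom I} * {cmonom I})) :=
  [seq (p.1, q) | p <- splits m, q <- splits p.2].
pose r2 : seq ({cmonom I} * ({cmonom I} * {cmonom I})) :=
  [seq (q.1, (q.2, p.2)) | p <- splits m, q <- splits p.1].
transitivity (\sum_(t <- r1) F t).
  rewrite big_allpairs_dep; apply: eq_bigr => p _; rewrite fps_mulE mulr_sumr.
  by apply: eq_bigr.
transitivity (\sum_(t <- r2) F t); last first.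
  rewrite big_allpairs_dep; apply: eq_bigr => p _; rewrite fps_mulE mulr_suml.
  by apply: eq_bigr => q _; rewrite /F /= mulrA.
apply: perm_big; apply: uniq_perm.
- apply: allpairs_uniq_dep => // t t' /allpairsPdep[p [q [_ + ->]]].
  rewrite mem_splits => /eqP qp /allpairsPdep[p' [q' [_ + ->]]].
  rewrite mem_splits => /eqP qp'; case: p p' q q' qp qp' => [a b] [a' b'] [c d] [c' d'] /=.
  by move=> <- <- [-> -> ->].
- apply: allpairs_uniq_dep => // t t' /allpairsPdep[p [q [_ + ->]]].
  rewrite mem_splits => /eqP qp /allpairsPdep[p' [q' [_ + ->]]].
  rewrite mem_splits => /eqP qp'; case: p p' q q' qp qp' => [a b] [a' b'] [c d] [c' d'] /=.
  by move=> <- <- [-> -> ->].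
move=> [a [b c]]; apply/allpairsPdep/allpairsPdep.
  move=> [[p1 p2] [[q1 q2] []]]; rewrite !mem_splits /= => /eqP pm /eqP qp [-> -> ->].
  by exists (mmul p1 q1, q2), (p1, q1); rewrite !mem_splits /= -mulmA qp pm !eqxx.
move=> [[p1 p2] [[q1 q2] []]]; rewrite !mem_splits /= => /eqP pm /eqP qp [-> -> ->].
by exists (q1, mmul q2 p2), (q2, p2); rewrite !mem_splits /= mulmA qp pm !eqxx.
Qed.

Lemma fps_mul1 : left_id (fpsC 1) fps_mul.
Proof.
move=> f; apply/fpsP=> m; rewrite fps_mulE (bigD1_seq (mone, m)) //=; last first.
  by rewrite mem_splits /= mul1m.
rewrite eqxx mul1r big_seq_cond big1 ?addr0 // => -[a b] /=.
rewrite mem_splits /= => /andP[/eqP abm neq]; case: eqP => [a1|]; last by rewrite mul0r.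
by move: neq; rewrite -abm a1 mul1m eqxx.
Qed.

Lemma fps_mulDl : left_distributive fps_mul fps_add.
Proof.
move=> f g h; apply/fpsP=> m.
transitivity (fcoef (fps_mul f h) m + fcoef (fps_mul g h) m); last by [].
by rewrite !fps_mulE -big_split; apply: eq_bigr => k _ /=; rewrite mulrDl.
Qed.

Lemma fps_1_neq0 : fpsC 1 != 0.
Proof.
apply/eqP => /fpsP /(_ mone) /=; rewrite eqxx => /eqP; apply/negP.
exact: oner_neq0.
Qed.

HB.instance Definition _ := GRing.Zmodule_isComNzRing.Build (fps I R)
  fps_mulA fps_mulC fps_mul1 fps_mulDl fps_1_neq0.

(* Possibly infinite sums, computed coefficientwise: the coefficient of m is
   0 by convention if infinitely many terms involve m. Every use below is on
   a family in which each monomial occurs only finitely often. *)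
Definition fps_sum (J : choiceType) (F : J -> fps I R) : fps I R :=
  FPS (fun m => \sum_(j \in [set: J]) fcoef (F j) m).

(* Series A = sum_(n : int) (A n) u^n, infinite in both directions. The
   product is only meaningful when the sums defining its coefficients are
   coefficientwise finite. *)
Definition useries := int -> fps I R.

Definition useries1 : useries := fun n => (n == 0)%:R.

Definition useries_mul (A B : useries) : useries :=
  fun n => fps_sum (fun k : int => A k * B (n - k)).

(* 1 / (1 - a u), expanded in powers of u *)
Definition geom_u (a : fps I R) : useries :=
  fun n => if 0 <= n then a ^+ `|n|%N else 0.

(* 1 / (1 - a u^-1), expanded in powers of u^-1 *)
Definition geom_uV (a : fps I R) : useries :=
  fun n => if n <= 0 then a ^+ `|n|%N else 0.

End Fps.

(* Z[beta][[x]]. Variables are indexed by nat, so there is a spurious x_0,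
   which does not occur below as all flag entries are positive. *)
Notation zbx := (fps nat {poly int}).

Definition beta : zbx := fpsC 'X.
Definition x_ (i : nat) : zbx := fpsX i.

Definition G_useries (p q : nat) : @useries nat {poly int} :=
  useries_mul (geom_uV (- beta))
    (\big[useries_mul/useries1]_(q <= i < p.+1)
       (fun n => (1 + beta * x_ i) * geom_u (x_ i) n)).

(* G_m^[p/q] *)
Definition G_row (p q : nat) (m : int) : zbx := G_useries p q m.

(* n (n - 1) ... (n - s + 1) / s`!, the division being exact *)
Definition binz (n : int) (s : nat) : int :=
  ((\prod_(t < s) (n - t%:Z)) %/ (s`!)%:Z)%Z.

Section Shape.
(* Rows are numbered from 0, columns from 1. *)
Variables (r : nat) (lam mu f g : 'I_r -> nat).

Definition is_partition (nu : 'I_r -> nat) : Prop :=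
  forall i j : 'I_r, (i <= j)%N -> (nu j <= nu i)%N.

Definition is_flagging : Prop :=
  forall i j : 'I_r, j = i.+1 :> nat -> (mu i < lam j)%N ->
    (g i <= g j)%N /\ (f i <= f j)%N.

Definition box := {c : 'I_r * 'I_(\max_(i < r) lam i).+1 |
  (mu c.1 < c.2 <= lam c.1)%N}.

Definition brow (c : box) : 'I_r := (val c).1.
Definition bcol (c : box) : nat := (val c).2.

Definition fmax : nat := \max_(i < r) f i.
Definition entry := 'I_fmax.+1.

Definition filling := {ffun box -> {set entry}}.

Definition emax (A : {set entry}) : nat := \max_(k in A) (k : nat).
(* fmax bounds every entry, so this is the minimum for nonempty A *)
Definition emin (A : {set entry}) : nat :=
  \big[minn/fmax]_(k in A) (k : nat).

Definition FSVT : {set filling} := [set T : filling |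
  [&& [forall c, (T c != finset.set0) &&
         [forall k in T c, (g (brow c) <= k <= f (brow c))%N]],
      [forall c, forall d, (brow d == brow c) && (bcol d == (bcol c).+1) ==>
         (emax (T c) <= emin (T d))%N] &
      [forall c, forall d, (brow d == (brow c).+1 :> nat) &&
         (bcol d == bcol c) ==> (emax (T c) < emin (T d))%N]]].

Definition fsize (T : filling) : nat := (\sum_c #|T c|)%N.

Definition G_tab : zbx :=
  \sum_(T in FSVT) beta ^+ (fsize T - #|{: box}|) *
     \prod_c \prod_(k in T c) x_ k.

Definition G_det : zbx :=
  \det (\matrix_(i < r, j < r) fps_sum (fun s : nat =>
    (binz (i%:Z - j%:Z) s)%:~R * beta ^+ s *
      G_row (f i) (g j) ((lam i)%:Z - (mu j)%:Z + j%:Z - i%:Z + s%:Z))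
    : 'M[zbx]_r).

End Shape.

(* Main.v *)
(** Both sides satisfy the same recursion, which peels off the smallest flag, as in
    Wachs' treatment of flagged Schur functions. Let [a] be the least lower flag
    among the nonempty rows and [k] the last nonempty row with [g k = a]; if some
    nonempty row has [f i < a], both sides vanish. Since
    [P = prod_(a <= i <= p) (1 + beta x_i) / (1 - x_i u)] satisfies
    [(1 - x_a u) P = (1 + beta x_a) P'], with [P'] the product from [a + 1],
    column [k] of the matrix is [x_a] times the column for [mu k + 1] plus
    [1 + beta x_a] times the column for [g k + 1]. On the tableau side this is the
    case analysis on the first box of row [k]: it is [{a}], or it does not contain
    [a], or it contains [a] and more. If [mu] takes the same value at [k] and
    [k - 1], then [mu k + 1] is not available, but then [g] does as well, and both
    sides are unchanged when [g k] is raised to [a + 1]: row [k] cannot contain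
    [a], and the term for [mu k + 1] can be removed by a column operation. *)
Require Import Defs.
From mathcomp Require Import all_boot all_order all_algebra.
From mathcomp Require Import finmap boolp classical_sets functions cardinality fsbigop.
From mathcomp Require Import perm monalg ring zify.

Set Implicit Arguments.
Unset Strict Implicit.
Unset Printing Implicit Defensive.

Import Order.TTheory GRing.Theory Num.Theory.

(** * Order and infinite sums of formal power series *)

Section Order.
Local Open Scope ring_scope.
Context {I : choiceType} {R : comNzRingType}.
Implicit Types (f g h : fps I R) (m : {cmonom I}) (n : int).

(** The bound is an integer so that it can be the index of [G_m]; for [n <= 0] it is vacuous. *)
Definition ord_ge n f := forall m, (mdeg m)%:Z < n -> fcoef f m = 0.

Lemma fcoefD f g m : fcoef (f + g) m = fcoef f m + fcoef g m.
Proof. by []. Qed.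

Lemma fcoefN f m : fcoef (- f) m = - fcoef f m.
Proof. by []. Qed.

Lemma fcoefM f g m :
  fcoef (f * g) m = \sum_(k \in msplit m) fcoef f k.1 * fcoef g k.2.
Proof. by []. Qed.

Lemma fcoef_sum (J : Type) (r : seq J) (F : J -> fps I R) m :
  fcoef (\sum_(j <- r) F j) m = \sum_(j <- r) fcoef (F j) m.
Proof. by elim/big_rec2: _ => // j y1 y2 _ <-; rewrite fcoefD. Qed.

Lemma ord_ge0 n : ord_ge n 0.
Proof. by []. Qed.

Lemma ord_ge_le0 n f : n <= 0 -> ord_ge n f.
Proof. by move=> n0 m; lia. Qed.

Lemma ord_geW n n' f : n' <= n -> ord_ge n f -> ord_ge n' f.
Proof. by move=> nn' fn m mn'; apply: fn; apply: lt_le_trans mn' nn'. Qed.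

Lemma ord_geD n f g : ord_ge n f -> ord_ge n g -> ord_ge n (f + g).
Proof. by move=> fn gn m mn; rewrite fcoefD fn // gn // addr0. Qed.

Lemma ord_geN n f : ord_ge n f -> ord_ge n (- f).
Proof. by move=> fn m mn; rewrite fcoefN fn // oppr0. Qed.

Lemma ord_geM n n' f g : ord_ge n f -> ord_ge n' g -> ord_ge (n + n') (f * g).
Proof.
move=> fn gn m mn; rewrite fcoefM fsbig1 // => -[a b] /= abm.
have := mdegM a b; rewrite {}abm => degm.
have [an|an] := ltP (mdeg a)%:Z n; first by rewrite fn // mul0r.
by rewrite gn ?mulr0 //; lia.
Qed.

Lemma ord_geMr n f g : ord_ge n f -> ord_ge n (g * f).
Proof. by move=> fn; rewrite -[n]add0r; apply: ord_geM => //; exact: ord_ge_le0. Qed.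

Lemma ord_geX i : ord_ge 1 (fpsX i : fps I R).
Proof. by move=> m /=; case: eqP => [->|//]; rewrite mdegU. Qed.

Lemma ord_ge_exp k f : ord_ge 1 f -> ord_ge k%:Z (f ^+ k).
Proof.
move=> f1; elim: k => [|k IHk]; first exact: ord_ge_le0.
by rewrite exprS -add1n PoszD; apply: ord_geM.
Qed.

Lemma eq_ord_ge f g : (forall N : nat, ord_ge N%:Z (f - g)) -> f = g.
Proof.
move=> fg; apply/fpsP => m; have := fg (mdeg m).+1 m.
by rewrite fcoefD fcoefN => /(_ (ltnSn _))/eqP; rewrite subr_eq0 => /eqP.
Qed.

(** The difference [d] satisfies [d = - f * d], hence [d = (- f) ^+ N * d] for every [N], so its
    order is at least every [N]. *)
Lemma mulfI_1D f g h : ord_ge 1 f -> (1 + f) * g = (1 + f) * h -> g = h.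
Proof.
move=> f1 /eqP; rewrite -subr_eq0 -mulrBr => /eqP.
set d := g - h => fd; suff: d = 0 by rewrite /d => /eqP; rewrite subr_eq0 => /eqP.
have dE : d = - f * d by apply/eqP; rewrite -subr_eq0 -fd; apply/eqP; ring.
apply: eq_ord_ge => N; rewrite subr0.
have -> : d = (- f) ^+ N * d.
  by elim: N => [|N IHN]; rewrite ?expr0 ?mul1r // exprSr -mulrA -dE.
by rewrite mulrC; apply/ord_geMr/ord_ge_exp/ord_geN.
Qed.

Lemma ord_ge_fps_sum (J : choiceType) (F : J -> fps I R) n :
  (forall j, ord_ge n (F j)) -> ord_ge n (fps_sum F).
Proof. by move=> Fn m mn /=; rewrite fsbig1 // => j _; apply: Fn. Qed.

Lemma fps_sum0 (J : choiceType) (F : J -> fps I R) :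
  (forall j, F j = 0) -> fps_sum F = 0.
Proof. by move=> F0; apply/fpsP => m /=; rewrite fsbig1 // => j _; rewrite F0. Qed.

Lemma fps_sum_reindex (J K : choiceType) (h : J -> K) (F : K -> fps I R) :
  injective h -> (forall k, (forall j, h j <> k) -> F k = 0) ->
  fps_sum F = fps_sum (F \o h).
Proof.
move=> hI F0; apply/fpsP => m /=.
transitivity (\sum_(k \in range h) fcoef (F k) m).
  apply/esym/fsbig_widen => // k [_ nk] /=; rewrite F0 // => j hj.
  by apply: nk; exists j.
apply: (@fsbig_image _ _ _ _ _ _ h (fun k => fcoef (F k) m)) => ? ? _ _; exact: hI.
Qed.

(** Orders growing at least linearly make every coefficient of [fps_sum F] a finite sum, so the
    convention for infinitely supported sums never applies. *)
Definition convergent (F : nat -> fps I R) :=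
  exists n : int, forall s, ord_ge (n + s%:Z) (F s).

(** Only finitely many terms matter below degree [N]; identities between infinite sums thus reduce,
    up to each order, to identities between partial sums. *)
Lemma fps_sum_trunc F : convergent F -> forall N : nat, exists K0, forall K, (K0 <= K)%N ->
  ord_ge N%:Z (fps_sum F - \sum_(s < K) F s).
Proof.
move=> [n Fn] N; exists `|N%:Z - n|%N => K K0K m mN.
rewrite fcoefD fcoefN fcoef_sum /=; apply/eqP; rewrite subr_eq0; apply/eqP.
rewrite (fsbig_ord _ _ (fun s => fcoef (F s) m)).
apply/esym/fsbig_widen => // s [_ /= /negP]; rewrite -leqNgt => Ks.
by apply: Fn; lia.
Qed.

Lemma convergentD F G : convergent F -> convergent G ->
  convergent (fun s => F s + G s).
Proof.
move=> [n Fn] [n' Gn]; exists (Num.min n n') => s.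
apply: ord_geD; first by apply: ord_geW (Fn s); lia.
by apply: ord_geW (Gn s); lia.
Qed.

Lemma convergentMl F a : convergent F -> convergent (fun s => a * F s).
Proof. by move=> [n Fn]; exists n => s; apply: ord_geMr. Qed.

Lemma convergentS F : convergent F -> convergent (fun s => F s.+1).
Proof. by move=> [n Fn]; exists (n + 1) => s; rewrite -addrA -PoszD. Qed.

Lemma fps_sumD F G : convergent F -> convergent G ->
  fps_sum (fun s => F s + G s) = fps_sum F + fps_sum G.
Proof.
move=> cF cG; apply: eq_ord_ge => N.
have [K1 H1] := fps_sum_trunc (convergentD cF cG) N.
have [K2 H2] := fps_sum_trunc cF N; have [K3 H3] := fps_sum_trunc cG N.
pose K := (K1 + K2 + K3)%N.
have {}H1 := H1 K ltac:(lia); have {}H2 := H2 K ltac:(lia).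
have {}H3 := H3 K ltac:(lia).
have := ord_geD H1 (ord_geN (ord_geD H2 H3)).
by rewrite big_split /=; congr ord_ge; ring.
Qed.

Lemma fps_sumMl F a : convergent F ->
  fps_sum (fun s => a * F s) = a * fps_sum F.
Proof.
move=> cF; apply: eq_ord_ge => N.
have [K1 H1] := fps_sum_trunc (convergentMl a cF) N.
have [K2 H2] := fps_sum_trunc cF N.
pose K := (K1 + K2)%N.
have {}H1 := H1 K ltac:(lia); have {}H2 := H2 K ltac:(lia).
have := ord_geD H1 (ord_geN (ord_geMr a H2)).
by rewrite -mulr_sumr; congr ord_ge; ring.
Qed.

Lemma fps_sumS F : convergent F ->
  fps_sum F = F 0%N + fps_sum (fun s => F s.+1).
Proof.
move=> cF; apply: eq_ord_ge => N.
have [K1 H1] := fps_sum_trunc (convergentS cF) N.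
have [K2 H2] := fps_sum_trunc cF N.
pose K := (K1 + K2)%N.
have {}H1 := H1 K ltac:(lia); have {}H2 := H2 K.+1 ltac:(lia).
have := ord_geD H2 (ord_geN H1).
by rewrite big_ord_recl; congr ord_ge; ring.
Qed.

Lemma useries_mul_nneg (A B : @useries I R) n : (forall k, k < 0 -> A k = 0) ->
  useries_mul A B n = fps_sum (fun k : nat => A k%:Z * B (n - k%:Z)).
Proof.
move=> A0; rewrite /useries_mul (fps_sum_reindex (h := Posz)) // => [? ? []//|k kP].
by rewrite A0 ?mul0r //; case: k kP => // k /(_ k).
Qed.

Lemma useries_mul_npos (A B : @useries I R) n : (forall k, 0 < k -> A k = 0) ->
  useries_mul A B n = fps_sum (fun k : nat => A (- k%:Z) * B (n + k%:Z)).
Proof.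
move=> A0; rewrite /useries_mul (fps_sum_reindex (h := fun k : nat => - k%:Z)).
- by congr fps_sum; apply/funext => k /=; rewrite opprK.
- by move=> a b /oppr_inj [].
move=> k kP; rewrite A0 ?mul0r // ltNge; apply/negP => k0.
by apply: (kP `|k|%N); lia.
Qed.

End Order.

(** * The series [G_m^[p/q]] and the entries of the determinant *)

Section Binomial.
Local Open Scope ring_scope.
Implicit Types (n : int) (s : nat).

Definition ffactz n s : int := \prod_(t < s) (n - t%:Z).

Lemma ffactzS n s : ffactz n s.+1 = ffactz n s * (n - s%:Z).
Proof. by rewrite /ffactz big_ord_recr. Qed.

Lemma ffactzSl n s : ffactz (n + 1) s.+1 = (n + 1) * ffactz n s.
Proof.
rewrite /ffactz big_ord_recl subr0; congr (_ * _); apply: eq_bigr => t _.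
by rewrite /= /bump /=; lia.
Qed.

Lemma ffactzD1 n s : ffactz (n + 1) s.+1 = ffactz n s.+1 + ffactz n s * s.+1%:Z.
Proof. by rewrite ffactzSl ffactzS intS; ring. Qed.

(** By [ffactzD1] and the case [s], moving [n] by one changes the falling factorial of length
    [s + 1] by a multiple of [(s + 1)!]. It vanishes at [n = 0], so induction in both directions
    covers all integers. *)
Lemma dvdz_ffactz n s : ((s`!)%:Z %| ffactz n s)%Z.
Proof.
elim: s n => [|s IHs] n; first exact: dvd1z.
have dS k : ((s.+1`!)%:Z %| ffactz k s * s.+1%:Z)%Z.
  by rewrite factS mulnC PoszM dvdz_mul.
elim: n => [|n|n].
- by rewrite /ffactz big_ord_recl subr0 mul0r dvdz0.
- by move=> IHn; rewrite intS addrC ffactzD1 rpredD.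
move=> IHn; have := ffactzD1 (- n.+1%:Z) s.
rewrite (_ : - n.+1%:Z + 1 = - n%:Z) => [/(canLR (addrK _)) <-|]; last lia.
by rewrite rpredB.
Qed.

Lemma binz0 n : binz n 0 = 1.
Proof. by rewrite /binz big_ord0. Qed.

Lemma binz0S s : binz 0 s.+1 = 0.
Proof. by rewrite /binz big_ord_recl subr0 mul0r div0z. Qed.

Lemma binzS n s : binz (n + 1) s.+1 = binz n s.+1 + binz n s.
Proof.
have F0 k : (k`!)%:Z != 0 by rewrite -lt0n fact_gt0.
have bE k j : binz k j * (j`!)%:Z = ffactz k j by apply: divzK; exact: dvdz_ffactz.
by apply: (mulIf (F0 s.+1)); rewrite mulrDl !bE ffactzD1 factS mulnC PoszM mulrA bE.
Qed.

End Binomial.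

Section Rows.
Local Open Scope ring_scope.
Implicit Types (n d : int) (p q a : nat).

Definition P_useries q e : @useries nat {poly int} :=
  \big[useries_mul/useries1]_(q <= i < e)
       (fun n => (1 + beta * x_ i) * geom_u (x_ i) n).

Lemma ord_ge_x i : ord_ge 1 (x_ i).
Proof. exact: ord_geX. Qed.

Lemma ord_ge_bx i : ord_ge 1 (beta * x_ i).
Proof. exact/ord_geMr/ord_ge_x. Qed.

Lemma P_useries_nil q e n : (e <= q)%N -> P_useries q e n = (n == 0)%:R.
Proof. by move=> eq; rewrite /P_useries big_geq. Qed.

Lemma P_useries_cons q e n : (q < e)%N ->
  P_useries q e n =
  fps_sum (fun k : nat => (1 + beta * x_ q) * x_ q ^+ k * P_useries q.+1 e (n - k%:Z)).
Proof.
move=> qe; rewrite {1}/P_useries big_ltn // useries_mul_nneg => [|k k0].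
  by [].
by rewrite /geom_u leNgt k0 mulr0.
Qed.

(** Each factor [u] comes with a variable. *)
Lemma ord_ge_P q e n : ord_ge n (P_useries q e n).
Proof.
have [m em] : exists m, (e - q = m)%N by exists (e - q)%N.
elim: m q n em => [|m IHm] q n em.
  rewrite P_useries_nil -?subn_eq0 ?em //.
  by case: eqP => [->|_]; [apply: ord_ge_le0 | apply: ord_ge0].
rewrite P_useries_cons; last by lia.
apply: ord_ge_fps_sum => k; rewrite -[X in ord_ge X](subrKC k%:Z).
by apply/ord_geM; [apply/ord_geMr/ord_ge_exp/ord_ge_x | apply: IHm; lia].
Qed.

Lemma P_useries_lt0 q e n : n < 0 -> P_useries q e n = 0.
Proof.
have [m em] : exists m, (e - q = m)%N by exists (e - q)%N.
elim: m q n em => [|m IHm] q n em n0.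
  rewrite P_useries_nil -?subn_eq0 ?em //.
  by case: eqP => // nE; rewrite nE in n0.
rewrite P_useries_cons; last by lia.
by rewrite fps_sum0 // => k; rewrite IHm ?mulr0 //; lia.
Qed.

Lemma P_useries_rec q e n : (q < e)%N ->
  P_useries q e n = x_ q * P_useries q e (n - 1) + (1 + beta * x_ q) * P_useries q.+1 e n.
Proof.
move=> qe; rewrite !(P_useries_cons _ qe).
have cv m : convergent (fun k : nat =>
    (1 + beta * x_ q) * x_ q ^+ k * P_useries q.+1 e (m - k%:Z)).
  exists 0 => k; rewrite add0r -[X in ord_ge X]addr0.
  by apply: ord_geM; [exact/ord_geMr/ord_ge_exp/ord_ge_x | exact: ord_ge_le0].
rewrite fps_sumS // expr0 mulr1 subr0 addrC; congr (_ + _).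
rewrite -fps_sumMl //; congr fps_sum; apply/funext => k.
by rewrite exprS intS opprD addrA; ring.
Qed.

Lemma G_rowE p q n :
  G_row p q n = fps_sum (fun k : nat => (- beta) ^+ k * P_useries q p.+1 (n + k%:Z)).
Proof.
rewrite /G_row /G_useries useries_mul_npos => [|k k0].
  congr fps_sum; apply/funext => k; rewrite /geom_uV.
  by rewrite abszN (_ : (- k%:Z <= 0) = true) //; lia.
by rewrite /geom_uV leNgt k0.
Qed.

Lemma convergent_G q e n :
  convergent (fun k : nat => (- beta) ^+ k * P_useries q e (n + k%:Z)).
Proof. by exists n => k; apply/ord_geMr/ord_ge_P. Qed.

Lemma ord_ge_G p q n : ord_ge n (G_row p q n).
Proof.
rewrite G_rowE; apply: ord_ge_fps_sum => k; apply: ord_geMr.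
by apply: ord_geW (@ord_ge_P _ _ _); lia.
Qed.

Lemma G_row_rec p q n : (q <= p)%N ->
  G_row p q n = x_ q * G_row p q (n - 1) + (1 + beta * x_ q) * G_row p q.+1 n.
Proof.
move=> qp; rewrite !G_rowE -!fps_sumMl; try exact: convergent_G.
rewrite -(fps_sumD (convergentMl _ (@convergent_G q p.+1 (n - 1)))
                   (convergentMl _ (@convergent_G q.+1 p.+1 n))).
congr fps_sum; apply/funext => k.
by rewrite {1}P_useries_rec // (_ : n + k%:Z - 1 = n - 1 + k%:Z); ring.
Qed.

(** This compares coefficients of [u^n] after multiplying the generating series by [1 + beta u^-1],
    which cancels its first factor. *)
Lemma G_rowDP p q n : G_row p q n + beta * G_row p q (n + 1) = P_useries q p.+1 n.
Proof.
rewrite !G_rowE fps_sumS; last exact: convergent_G.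
rewrite expr0 mul1r addr0 -addrA -fps_sumMl; last exact: convergent_G.
rewrite -[RHS]addr0; congr (_ + _).
rewrite -(fps_sumD (convergentS (@convergent_G q p.+1 n))
                   (convergentMl _ (@convergent_G q p.+1 (n + 1)))).
by apply: fps_sum0 => k; rewrite intS exprS addrA; ring.
Qed.

Lemma G_row_nil p q n : (p < q)%N -> 0 < n -> G_row p q n = 0.
Proof.
move=> pq n0; rewrite G_rowE fps_sum0 // => k.
by rewrite P_useries_nil //; case: eqP => [|_]; [lia | exact: mulr0].
Qed.

(** By [G_rowDP] at [-1], [G_{-1} = - beta G_0]. Inserted in [G_row_rec], this gives
    [(1 + beta x_q) G_0 = (1 + beta x_q) G_0'], where [G_0'] has one variable fewer, and the factor
    cancels. *)
Lemma G_row0 p q : G_row p q 0 = 1.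
Proof.
have [m em] : exists m, (p.+1 - q = m)%N by exists (p.+1 - q)%N.
elim: m q em => [|m IHm] q em.
  have pq : (p < q)%N by lia.
  have := G_rowDP p q 0; rewrite add0r (@G_row_nil _ _ 1 pq) // mulr0 addr0 => ->.
  by rewrite P_useries_nil.
apply: (mulfI_1D (ord_ge_bx q)).
have := @G_row_rec p q 0; rewrite (IHm q.+1) ?sub0r; last by lia.
have := G_rowDP p q (- 1); rewrite P_useries_lt0 // addNr => /eqP.
rewrite addr_eq0 => /eqP -> /(_ ltac:(lia)) E.
by rewrite mulrDl mul1r {1}E; ring.
Qed.

(** The coefficient of [u^n] in [(1 + beta u^-1)^d] times the generating series of [G_row p q]; [d]
    is [i - j] in the determinant. *)
Definition E_row d p q n : zbx :=
  fps_sum (fun s : nat => (binz d s)%:~R * beta ^+ s * G_row p q (n + s%:Z)).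

Lemma convergent_E d p q n :
  convergent (fun s : nat => (binz d s)%:~R * beta ^+ s * G_row p q (n + s%:Z)).
Proof. by exists n => k; apply/ord_geMr/ord_ge_G. Qed.

Lemma E_row0 p q n : E_row 0 p q n = G_row p q n.
Proof.
rewrite /E_row fps_sumS; last exact: convergent_E.
rewrite binz0 expr0 mulr1 mul1r addr0 fps_sum0 ?addr0 // => s.
by rewrite binz0S mul0r mul0r.
Qed.

Lemma E_row_rec d p q n : (q <= p)%N ->
  E_row d p q n = x_ q * E_row d p q (n - 1) + (1 + beta * x_ q) * E_row d p q.+1 n.
Proof.
move=> qp; rewrite /E_row -!fps_sumMl; try exact: convergent_E.
rewrite -(fps_sumD (convergentMl _ (@convergent_E d p q (n - 1)))
                   (convergentMl _ (@convergent_E d p q.+1 n))).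
congr fps_sum; apply/funext => k.
by rewrite {1}G_row_rec // (_ : n + k%:Z - 1 = n - 1 + k%:Z); ring.
Qed.

Lemma E_row_pascal d p q n :
  E_row (d + 1) p q n = E_row d p q n + beta * E_row d p q (n + 1).
Proof.
rewrite /E_row fps_sumS; last exact: convergent_E.
rewrite [X in _ = X + _]fps_sumS; last exact: convergent_E.
rewrite !binz0 -addrA; congr (_ + _).
rewrite -fps_sumMl; last exact: convergent_E.
rewrite -(fps_sumD (convergentS (@convergent_E d p q n))
                   (convergentMl _ (@convergent_E d p q (n + 1)))).
congr fps_sum; apply/funext => k.
by rewrite binzS rmorphD exprS intS addrA /=; ring.
Qed.

(** One factor [1 + beta u^-1] cancels the denominator of the generating series and leaves
    [(1 + beta u^-1)^d P]. As [P] is a power series in [u], no exponent is below [-d]. *)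
Lemma E_row_low (d : nat) p q n : n < - d%:Z -> E_row d.+1%:Z p q n = 0.
Proof.
elim: d n => [|d IHd] n nd.
  rewrite -[1%:Z]add0r E_row_pascal !E_row0 G_rowDP P_useries_lt0 //; lia.
by rewrite intS addrC E_row_pascal !IHd ?mulr0 ?addr0 //; lia.
Qed.

Lemma E_row_nil d p q n : (p < q)%N -> 0 < n -> E_row d p q n = 0.
Proof.
move=> pq n0; apply: fps_sum0 => s; rewrite G_row_nil ?mulr0 //; lia.
Qed.

End Rows.

(** * Recursion for the determinant *)

Definition incr r (h : 'I_r -> nat) (k i : 'I_r) : nat := h i + (i == k).

Lemma incr_id r (h : 'I_r -> nat) k : incr h k k = (h k).+1.
Proof. by rewrite /incr eqxx addn1. Qed.

Lemma incr_neq r (h : 'I_r -> nat) k i : i != k -> incr h k i = h i.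
Proof. by rewrite /incr => /negbTE ->; rewrite addn0. Qed.

(** The easy half of the Frobenius-König theorem: a permutation cannot map [S] into the smaller set
    [C], so every term of the determinant has a zero factor. *)
Lemma det_zero_block (R : comNzRingType) n (A : 'M[R]_n) (S C : {set 'I_n}) :
  #|C| < #|S| -> (forall i j, i \in S -> j \notin C -> A i j = 0%R) ->
  (\det A = 0)%R.
Proof.
move=> CS A0; apply: big1 => /= s _.
have /subsetPn[_ /imsetP[i iS ->] siC] : ~~ ([set (s : {perm 'I_n}) i | i in S] \subset C).
  apply/negP => /subset_leq_card; rewrite card_imset; last exact: perm_inj.
  by rewrite leqNgt CS.
by rewrite (bigD1 i) //= A0 // mul0r mulr0.
Qed.

(* Entrywise form of [determinant_multilinear]: over [zbx], unfolding the scaling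
   of row vectors is prohibitively slow. *)
Lemma determinant_linear_row (R : comNzRingType) n (A B C : 'M[R]_n) i0 b c :
  (forall j, A i0 j = b * B i0 j + c * C i0 j)%R ->
  (forall i j, i != i0 -> B i j = A i j) -> (forall i j, i != i0 -> C i j = A i j) ->
  (\det A = b * \det B + c * \det C)%R.
Proof.
move=> Ai0 BA CA; apply: (determinant_multilinear (i0 := i0)).
- by apply/rowP => j; rewrite !mxE.
- by apply/matrixP => i j; rewrite !mxE BA // eq_sym neq_lift.
by apply/matrixP => i j; rewrite !mxE CA // eq_sym neq_lift.
Qed.

Section JacobiTrudi.
Local Open Scope ring_scope.
Variables (r : nat) (lam f : 'I_r -> nat).
Implicit Types (mu g : 'I_r -> nat) (i j k : 'I_r) (m q : nat).

(** [m] and [q] stand for [mu j] and [g j]; the recursions change them independently of [j]. *)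
Definition jt_entry i j m q : zbx :=
  E_row (i%:Z - j%:Z) (f i) q ((lam i)%:Z - m%:Z + j%:Z - i%:Z).

(* The transpose of the matrix of [G_det], whose row [j] only involves [mu j] and [g j]. *)
Definition jt_mx mu g : 'M[zbx]_r := \matrix_(j, i) jt_entry i j (mu j) (g j).

Lemma G_detE mu g : G_det lam mu f g = \det (jt_mx mu g).
Proof. by rewrite -det_tr; congr (\det _); apply/matrixP => i j; rewrite !mxE. Qed.

Lemma jt_entry_low i j m q : (j < i)%N -> (lam i <= m)%N -> jt_entry i j m q = 0.
Proof.
move=> ji lm; rewrite /jt_entry (_ : i%:Z - j%:Z = (i - j).-1.+1%:Z); last by lia.
by apply: E_row_low; lia.
Qed.

Lemma jt_entry_nil i j m q :
  (f i < q)%N -> (i <= j)%N -> (m < lam i)%N -> jt_entry i j m q = 0.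
Proof. by move=> fq ij lm; apply: E_row_nil => //; lia. Qed.

Lemma jt_entry_diag i m q : lam i = m -> jt_entry i i m q = 1.
Proof. by move=> <-; rewrite /jt_entry !subrr E_row0 G_row0. Qed.

Lemma jt_entry_rec i j m q : (q <= f i)%N ->
  jt_entry i j m q = x_ q * jt_entry i j m.+1 q + (1 + beta * x_ q) * jt_entry i j m q.+1.
Proof.
move=> qf; rewrite /jt_entry [LHS]E_row_rec //; congr (_ * E_row _ _ _ _ + _); lia.
Qed.

(** Pascal's rule for [i - j = (i - k) + 1]; the index is unchanged when column and [m] both go up
    by one. *)
Lemma jt_entry_shift i j k m q : k = j.+1 :> nat ->
  jt_entry i j m q = jt_entry i k m.+1 q + beta * jt_entry i k m q.
Proof.
move=> kj; rewrite /jt_entry (_ : i%:Z - j%:Z = i%:Z - k%:Z + 1); last by lia.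
rewrite (_ : _ + j%:Z - i%:Z = (lam i)%:Z - m.+1%:Z + k%:Z - i%:Z); last by lia.
by rewrite E_row_pascal; congr (_ + _ * E_row _ _ _ _); lia.
Qed.

Section Step.
Variables (mu g : 'I_r -> nat) (k : 'I_r).
Hypotheses (lam_part : is_partition lam) (mu_part : is_partition mu).
Hypotheses (mu_lam : forall i, (mu i <= lam i)%N) (k_lt : (mu k < lam k)%N).
Hypothesis (f_ge : forall i, (mu i < lam i)%N -> (g k <= f i)%N).

(** If [f i < g k], then [jt_entry_rec] does not apply, but row [i] of the shape is empty and all
    three entries vanish: for [i > k] by [jt_entry_low], for [i < k] because the product is empty
    and the index positive. *)
Lemma jt_column_rec i : jt_entry i k (mu k) (g k) =
  x_ (g k) * jt_entry i k (mu k).+1 (g k) +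
  (1 + beta * x_ (g k)) * jt_entry i k (mu k) (g k).+1.
Proof.
have [/jt_entry_rec //|fg] := leqP (g k) (f i).
have mui : mu i = lam i.
  by apply/eqP; rewrite eqn_leq mu_lam leqNgt; apply/negP => /f_ge; rewrite leqNgt fg.
have [ki|ik|ki] := ltngtP k i; last by have := k_lt; rewrite (val_inj ki) mui ltnn.
  have := mu_part (ltnW ki); rewrite mui => lm.
  by rewrite !jt_entry_low ?mulr0 ?addr0 // leqW.
have lki := lam_part (ltnW ik).
rewrite (jt_entry_nil fg) ?(jt_entry_nil (leqW fg)) ?(ltnW ik) //; try lia.
(* Here [mu k + 1] may equal [lam i], but [i < k] still makes the index positive. *)
rewrite [jt_entry _ _ _ _](_ : _ = 0) ?mulr0 ?addr0 //.
by apply: E_row_nil => //; lia.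
Qed.

Lemma det_jt_step : \det (jt_mx mu g) =
  x_ (g k) * \det (jt_mx (incr mu k) g) +
  (1 + beta * x_ (g k)) * \det (jt_mx mu (incr g k)).
Proof.
apply: (determinant_linear_row (i0 := k)) => [i|j i jk|j i jk]; rewrite !mxE.
- by rewrite !incr_id jt_column_rec.
- by rewrite incr_neq.
by rewrite incr_neq.
Qed.

(* Column [j] is the sum of column [k] for [mu k + 1] and [beta] times column [k]. *)
Lemma det_jt_same (j : 'I_r) : k = j.+1 :> nat -> mu j = mu k -> g j = g k ->
  \det (jt_mx mu g) = \det (jt_mx mu (incr g k)).
Proof.
move=> kj muj gj; apply: (mulfI_1D (ord_ge_bx (g k))).
(* Row [k] is computed with [j] in place of [k], which makes it equal to row [j]. *)
pose D : 'M[zbx]_r := \matrix_(l, i)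
  jt_entry i (if l == k then j else l) (mu l) (g l).
have jk : j != k by rewrite -val_eqE /= kj; lia.
have D0 : \det D = 0.
  by apply: (determinant_alternate jk) => i; rewrite !mxE eqxx (negbTE jk) muj gj.
have DE : \det D = 1 * \det (jt_mx (incr mu k) g) + beta * \det (jt_mx mu g).
  apply: (determinant_linear_row (i0 := k)) => [i|l i lk|l i lk]; rewrite !mxE.
  - by rewrite eqxx incr_id mul1r; exact: jt_entry_shift.
  - by rewrite incr_neq // (negbTE lk).
  by rewrite (negbTE lk).
have BE : \det (jt_mx (incr mu k) g) = - (beta * \det (jt_mx mu g)).
  by apply/eqP; rewrite -addr_eq0 -D0 DE mul1r.
(* The term for [mu k + 1] is now [- beta x] times the determinant, where [x = x_ (g k)]; moved to
   the left, it yields the common factor [1 + beta x]. *)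
have := det_jt_step; rewrite BE.
move: (\det (jt_mx mu g)) (\det (jt_mx mu (incr g k))) => d e dE.
by rewrite mulrDl mul1r {1}dE; ring.
Qed.

End Step.

Lemma det_jt_empty mu g : is_partition mu -> (forall i, mu i = lam i) ->
  \det (jt_mx mu g) = 1.
Proof.
move=> mu_part mul; rewrite det_trig.
  by rewrite big1 // => i _; rewrite mxE jt_entry_diag.
apply/is_trig_mxP => j i ji; rewrite mxE jt_entry_low //.
by rewrite -mul; apply/mu_part/ltnW.
Qed.

(** Moving up inside a connected component does not increase [f], so [i] may be taken to be the
    first row of its component. Then [#|C| + 1] rows are supported on [#|C|] columns. *)
Lemma det_jt_eq0 mu g (i : 'I_r) : is_partition lam -> is_partition mu ->
  is_flagging lam mu f g -> (mu i < lam i)%N ->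
  (forall j, (mu j < lam j)%N -> (f i < g j)%N) -> \det (jt_mx mu g) = 0.
Proof.
move=> lam_part mu_part fl.
have [n] := ubnP (i : nat); elim: n i => // n IHn i /ltnSE ni mui fg.
have [/existsP[j /andP[/eqP ij muj]]|first] :=
  boolP [exists j : 'I_r, (i == j.+1 :> nat) && (mu j < lam i)%N].
  have [_ fji] := fl _ _ ij muj; apply: (IHn j); first by lia.
    by apply: leq_trans muj _; apply: lam_part; rewrite ij leqW.
  by move=> l /fg; apply: leq_ltn_trans.
rewrite -det_tr.
(* Now row [i] begins a connected component of the shape. The rows [t] in [C], those of
   the later components, vanish outside of [C], and so does row [i], by the flags. *)
pose C : {set 'I_r} := [set t : 'I_r | (i < t)%N &&
  [exists e : 'I_r, exists e' : 'I_r,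
     [&& i <= e, e' == e.+1 :> nat, e' <= t & lam e' <= mu e]%N]].
apply: (@det_zero_block _ _ _ (i |: C) C).
  by rewrite cardsU1 [i \in C]inE ltnn add1n.
move=> t j; rewrite !mxE in_setU1 => tC jC.
(* Columns before [i] vanish on all these rows: as [i] begins a component,
   [lam t <= lam i <= mu (i - 1) <= mu j]. *)
have [ji|ij] := ltnP j i.
  have it : (i <= t)%N by case/orP: tC => [/eqP ->//|]; rewrite inE => /andP[/ltnW].
  apply: jt_entry_low; first exact: leq_trans ji it.
  have i0 : (0 < i)%N by lia.
  have i'r : (i.-1 < r)%N by have := ltn_ord i; lia.
  pose i' := Ordinal i'r.
  have ii' : i = i'.+1 :> nat by rewrite /= prednK.
  move/existsPn/(_ i'): first; rewrite {1}ii' eqxx /= -leqNgt => le.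
  apply: leq_trans (lam_part _ _ it) (leq_trans le _).
  by apply: mu_part => /=; lia.
case/predU1P: tC => [->|].
  (* Between [i] and a column [j] outside of [C] there is no break [lam (e + 1) <= mu e], so
     nonemptiness propagates from row [i] to row [j], and the flag of row [j] exceeds [f i]. *)
  have cp : forall d, (i + d <= j)%N -> forall l : 'I_r, l = (i + d)%N :> nat ->
      (mu l < lam l)%N.
    elim=> [|d IHd] dj l ld; first by rewrite (_ : l = i) //; apply: val_inj; rewrite /= ld addn0.
    have l'r : (i + d < r)%N by have := ltn_ord l; lia.
    have := IHd ltac:(lia) (Ordinal l'r) erefl => ml'.
    apply: leq_ltn_trans (mu_part (Ordinal l'r) l _) _; first by rewrite ld /=; lia.
    rewrite ltnNge; apply: contra jC => le; rewrite inE; apply/andP; split; first by lia.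
    apply/existsP; exists (Ordinal l'r); apply/existsP; exists l.
    by rewrite leq_addr /= ld addnS eqxx le !andbT /=; lia.
  have mj : (mu j < lam j)%N by apply: (cp (j - i)%N) => //; lia.
  apply: jt_entry_nil => //; first exact: fg.
  by apply: leq_trans mj _; apply: lam_part.
rewrite inE => /andP[it /existsP[e /existsP[e' /and4P[ie /eqP ee et le]]]].
(* A column outside of [C] cannot lie after the break at [e], whereas row [t] does; hence
   [lam t <= mu e <= mu j]. *)
have je : (j <= e)%N.
  rewrite leqNgt; apply: contra jC => ej; rewrite inE; apply/andP; split; first by lia.
  by apply/existsP; exists e; apply/existsP; exists e'; rewrite ie ee eqxx le /= andbT.
apply: jt_entry_low; first by lia.
apply: leq_trans (lam_part _ _ et) _; apply: leq_trans le _; exact: mu_part.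
Qed.

End JacobiTrudi.

(** * Recursion for the tableaux *)

Section Tableaux.
Variables (r : nat) (lam f : 'I_r -> nat).
Implicit Types (mu g : 'I_r -> nat).

Definition cell : finType := ('I_r * 'I_(\max_(i < r) lam i).+1)%type.

Definition in_shape mu (c : cell) := mu c.1 < c.2 <= lam c.1.

(* Set-valued tableaux on a fixed set of cells: those outside of the skew shape are
   empty, so that the skew shape can vary without changing the type. *)
Definition gfilling := {ffun cell -> {set entry f}}.
Implicit Types (T U : gfilling) (c d : cell) (A : {set entry f}).

Definition is_tableau mu g T : Prop :=
  [/\ forall c, (T c != finset.set0) = in_shape mu c,
      forall c x, x \in T c -> g c.1 <= x <= f c.1,
      forall c d x y, d.1 = c.1 -> d.2 = c.2.+1 :> nat ->
        x \in T c -> y \in T d -> x <= y &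
      forall c d x y, d.1 = c.1.+1 :> nat -> d.2 = c.2 ->
        x \in T c -> y \in T d -> x < y].

(* The predecessor is truncated: the empty set has weight 1. *)
Definition weight A : zbx := (beta ^+ #|A|.-1 * \prod_(k in A) x_ k)%R.

Definition gen_tableau mu g : zbx :=
  (\sum_(T : gfilling | `[< is_tableau mu g T >]) \prod_c weight (T c))%R.

Lemma weight0 : weight finset.set0 = 1%R.
Proof. by rewrite /weight cards0 big_set0 mulr1. Qed.

Lemma weight1 x : weight [set x] = x_ x.
Proof. by rewrite /weight cards1 big_set1 mul1r. Qed.

Lemma weightU1 x A : x \notin A -> A != finset.set0 ->
  weight (x |: A) = (beta * x_ x * weight A)%R.
Proof.
move=> xA; rewrite -card_gt0 /weight cardsU1 xA add1n => /prednK {1}<-.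
by rewrite big_setU1 //= exprS mulrACA.
Qed.

Lemma emax_le_emin (A B : {set entry f}) : A != finset.set0 ->
  (emax A <= emin B) <-> (forall x y, x \in A -> y \in B -> x <= y).
Proof.
move=> /finset.set0Pn[x0 x0A]; rewrite /emin -minEnat; split.
  move=> AB x y xA yB; apply: leq_trans (leq_trans AB _).
    exact: (@leq_bigmax_cond _ _ (fun k : entry f => k : nat)).
  exact: (@bigmin_le_cond _ _ _ _ _ _ (fun k : entry f => k : nat)).
move=> AB; apply/(@bigmin_geP _ nat); split.
  by apply/bigmax_leqP => x _; rewrite -ltnS ltn_ord.
by move=> y yB; apply/bigmax_leqP => x xA; apply: AB.
Qed.

Lemma emax_lt_emin (A B : {set entry f}) : A != finset.set0 -> B != finset.set0 ->
  (emax A < emin B) <-> (forall x y, x \in A -> y \in B -> x < y).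
Proof.
move=> /finset.set0Pn[x0 x0A] /finset.set0Pn[y0 y0B]; rewrite /emin -minEnat; split.
  move=> AB x y xA yB; apply: leq_ltn_trans (leq_trans AB _).
    exact: (@leq_bigmax_cond _ _ (fun k : entry f => k : nat)).
  exact: (@bigmin_le_cond _ _ _ _ _ _ (fun k : entry f => k : nat)).
move=> AB.
have ltA y : y \in B -> emax A < y.
  move=> yB; rewrite -[y : nat](ltn_predK (AB _ _ x0A yB)) ltnS.
  apply/bigmax_leqP => x xA.
  by rewrite -ltnS (ltn_predK (AB _ _ x0A yB)) AB.
apply/(@bigmin_geP _ nat); split; last by move=> y /ltA.
(* The default value [fmax] of [emin] must exceed [emax A] too; the element [y0] of [B] ensures
   this. *)
by apply: leq_trans (ltA _ y0B) _; rewrite -ltnS ltn_ord.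
Qed.

Lemma big_cell_box (R : Type) (idx : R) (op : Monoid.com_law idx) mu (F : cell -> R) :
  (forall c, ~~ in_shape mu c -> F c = idx) ->
  \big[op/idx]_c F c = \big[op/idx]_(b : box lam mu) F (val b).
Proof.
move=> F1; rewrite (bigID (in_shape mu)) /= [X in op _ X]big1 //.
rewrite Monoid.mulm1; exact: (@big_sub _ _ op cell (in_shape mu) F).
Qed.

Definition extend mu (T : filling lam mu f) : gfilling :=
  [ffun c => if insub c is Some b then T b else finset.set0].

Definition restrict mu T : filling lam mu f := [ffun b => T (val b)].

Lemma extend_box mu (T : filling lam mu f) (b : box lam mu) : extend T (val b) = T b.
Proof. by rewrite ffunE valK. Qed.

Lemma extend_out mu (T : filling lam mu f) c :
  ~~ in_shape mu c -> extend T c = finset.set0.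
Proof. by move=> nc; rewrite ffunE insubN. Qed.

Lemma extendK mu : cancel (@extend mu) (restrict mu).
Proof. by move=> T; apply/ffunP => b; rewrite ffunE extend_box. Qed.

Lemma restrictK mu g T : is_tableau mu g T -> extend (restrict mu T) = T.
Proof.
case=> Tsh _ _ _; apply/ffunP => c; rewrite ffunE; case: insubP => [b _ <-|nc].
  by rewrite ffunE.
by apply/esym/eqP; rewrite -[_ == _]negbK Tsh.
Qed.

Lemma FSVTE mu g (T : filling lam mu f) :
  (T \in FSVT lam mu f g) = `[< is_tableau mu g (extend T) >].
Proof.
have outE c x : x \in extend T c -> exists b : box lam mu, c = val b.
  case: (boolP (in_shape mu c)) => [sc _|nc]; last by rewrite extend_out ?inE.
  by exists (Sub c sc); rewrite SubK.
rewrite finset.inE; apply/and3P/asboolP => [[/forallP T1 /forallP T3 /forallP T4]|].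
  have T0 (b : box lam mu) : T b != finset.set0 by have /andP[] := T1 b.
  split.
  - move=> c; case: (boolP (in_shape mu c)) => [sc|nc].
      by have := extend_box T (Sub c sc); rewrite SubK => ->; rewrite T0.
    by rewrite extend_out // eqxx.
  - move=> c x xc; have [b cE] := outE _ _ xc; move: xc; rewrite cE extend_box => xb.
    by have /andP[_ /forallP/(_ x)/implyP/(_ xb)] := T1 b.
  - move=> c d x y dc1 dc2 xc yd; have [b cE] := outE _ _ xc; have [e dE] := outE _ _ yd.
    move: xc yd dc1 dc2; rewrite cE dE !extend_box => xb ye dc1 dc2.
    have /forallP/(_ e)/implyP := T3 b; rewrite /brow /bcol dc1 dc2 !eqxx => /(_ isT).
    by move/(emax_le_emin _ (T0 b)) => /(_ x y xb ye).
  move=> c d x y dc1 dc2 xc yd; have [b cE] := outE _ _ xc; have [e dE] := outE _ _ yd.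
  move: xc yd dc1 dc2; rewrite cE dE !extend_box => xb ye dc1 dc2.
  have /forallP/(_ e)/implyP := T4 b; rewrite /brow /bcol dc1 dc2 !eqxx => /(_ isT).
  by move/(emax_lt_emin (T0 b) (T0 e)) => /(_ x y xb ye).
case=> U1 U2 U3 U4.
have T0 (b : box lam mu) : T b != finset.set0 by rewrite -extend_box U1; apply: (valP b).
split.
- apply/forallP => b; rewrite T0; apply/forallP => x; apply/implyP => xb.
  by apply: U2; rewrite extend_box.
- apply/forallP => b; apply/forallP => e; apply/implyP => /andP[/eqP e1 /eqP e2].
  apply/(emax_le_emin _ (T0 b)) => x y xb ye.
  by apply: (U3 (val b) (val e)); rewrite ?extend_box.
apply/forallP => b; apply/forallP => e; apply/implyP => /andP[/eqP e1 /eqP e2].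
apply/(emax_lt_emin (T0 b) (T0 e)) => x y xb ye.
by apply: (U4 (val b) (val e)); rewrite ?extend_box //; apply: val_inj.
Qed.

(** Extension by empty sets is a bijection between the two kinds of tableaux, and the added cells
    have weight 1. *)
Lemma G_tabE mu g : G_tab lam mu f g = gen_tableau mu g.
Proof.
rewrite /gen_tableau (reindex_onto (@extend mu) (restrict mu)) /=; last first.
  by move=> T /asboolP; apply: restrictK.
apply: eq_big => [T|T]; first by rewrite FSVTE extendK eqxx andbT.
rewrite FSVTE => /asboolP[T0 _ _ _].
rewrite (@big_cell_box _ _ _ mu) => [|c nc]; last by rewrite extend_out ?weight0.
rewrite [RHS](eq_bigr (fun b => weight (T b))) => [|b _]; last by rewrite extend_box.
rewrite big_split prodrXr /=; congr (beta ^+ _ * _)%R.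
(* The truncated subtraction distributes over the boxes because each of them holds at least one
   entry. *)
rewrite /fsize -sum1_card -sumnB => [|b _]; first by apply: eq_bigr => b _; rewrite subn1.
by rewrite card_gt0 -extend_box T0; apply: (valP b).
Qed.

End Tableaux.

(** * Changing the first box of a row *)

Section Recurrences.
Variables (r : nat) (lam f : 'I_r -> nat).
Implicit Types (mu g : 'I_r -> nat).
Local Notation cell := (cell lam).
Local Notation gfilling := (gfilling lam f).
Implicit Types (T U : gfilling) (c d : cell) (A : {set entry f}).

Lemma cell_eq c d : c.1 = d.1 -> c.2 = d.2 :> nat -> c = d.
Proof. by case: c d => [i j] [i' j'] /= -> /val_inj ->. Qed.

Lemma is_tableau_out mu g T c : is_tableau mu g T -> ~~ in_shape mu c ->
  T c = finset.set0.
Proof. by case=> Tsh _ _ _ nc; apply/eqP; rewrite -[_ == _]negbK Tsh. Qed.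

Lemma in_tableau mu g T c x : is_tableau mu g T -> x \in T c -> in_shape mu c.
Proof.
by move=> Tt; apply: contraLR => /(is_tableau_out Tt) ->; rewrite finset.inE.
Qed.

Lemma gen_tableau_empty mu g : (forall i, mu i = lam i) -> gen_tableau lam f mu g = 1%R.
Proof.
move=> mul.
have nsh c : in_shape mu c = false by rewrite /in_shape mul; lia.
rewrite /gen_tableau (big_pred1 [ffun=> finset.set0]) /= => [|T].
  by rewrite big1 // => c _; rewrite ffunE weight0.
apply/asboolP/eqP => [Tt|->].
  by apply/ffunP => c; rewrite ffunE (is_tableau_out Tt) // nsh.
split=> [c|c x|c d x y _ _|c d x y _ _]; rewrite ffunE ?finset.inE //.
by rewrite eqxx nsh.
Qed.

Lemma first_box (k : 'I_r) mu : mu k < lam k ->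
  exists2 b : cell, b.1 = k & b.2 = (mu k).+1 :> nat.
Proof.
move=> mk; have lt : (mu k).+1 < (\max_(i < r) lam i).+1.
  by apply: leq_ltn_trans mk _; rewrite ltnS; apply: leq_bigmax.
by exists (k, Ordinal lt).
Qed.

Lemma gen_tableau_eq0 mu g (i : 'I_r) : mu i < lam i -> f i < g i ->
  gen_tableau lam f mu g = 0%R.
Proof.
move=> mi fg; rewrite /gen_tableau big_pred0 // => T; apply/asboolP => -[Tsh Tfl _ _].
have [b b1 b2] := first_box mi.
have /finset.set0Pn[x /Tfl] : T b != finset.set0 by rewrite Tsh /in_shape b1 b2 ltnS leqnn.
by rewrite b1; lia.
Qed.

(** Induction on the column: the left neighbour of a cell beyond [b] is in the shape, hence
    nonempty, and passes the bound on. *)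
Lemma tableau_row_ge mu g T (b : cell) v c x : is_tableau mu g T ->
  b.2 = (mu b.1).+1 :> nat -> (forall y, y \in T b -> v <= y) ->
  c.1 = b.1 -> x \in T c -> v <= x.
Proof.
move=> Tt b2 bv; have [Tsh _ Trow _] := Tt.
have [n] := ubnP (c.2 : nat); elim: n c x => // n IHn c x /ltnSE cn c1 xc.
have := in_tableau Tt xc; rewrite /in_shape c1 => /andP[mc cl].
have [cb|cb] := leqP c.2 b.2.
  apply: bv; suff <- : c = b by [].
  by apply: cell_eq => //; apply/eqP; rewrite eqn_leq cb b2.
have lt : (c.2.-1 < (\max_(i < r) lam i).+1) by have := ltn_ord c.2; lia.
pose d : cell := (b.1, Ordinal lt).
have /finset.set0Pn[y yd] : T d != finset.set0.
  by rewrite Tsh /in_shape /= (leq_trans (leq_pred _) cl) ltn_predRL -b2 cb.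
have c0 : 0 < c.2 by apply: leq_ltn_trans cb.
have vy : v <= y by apply: (IHn d) yd => //=; apply: leq_trans cn; rewrite prednK.
by apply: leq_trans vy _; apply: (Trow d c) => //=; rewrite prednK.
Qed.

(** Rows increase weakly, so a lower bound on the first box holds on the entire row. *)
Lemma is_tableau_incr_flag mu g T (b : cell) : b.2 = (mu b.1).+1 :> nat ->
  is_tableau mu (incr g b.1) T <->
  is_tableau mu g T /\ (forall x, x \in T b -> g b.1 < x).
Proof.
move=> b2; split=> [[Tsh Tfl Trow Tcol]|[Tt gb]].
  split; last by move=> x /Tfl; rewrite incr_id => /andP[].
  by split=> // c x /Tfl; rewrite /incr; lia.
have [Tsh Tfl Trow Tcol] := Tt; split=> // c x xc.
have /andP[gx ->] := Tfl _ _ xc; rewrite andbT /incr.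
case: eqP => [cb|_]; last by rewrite addn0.
by rewrite addn1 cb; apply: (tableau_row_ge Tt b2 gb cb xc).
Qed.

Section Step.
Variables (mu g : 'I_r -> nat) (k : 'I_r).
Hypothesis (k_lt : mu k < lam k).

(** As [mu j = mu k], the first box of row [k] has a box above it; the entries there are at least
    [g j = g k], so those below exceed [g k]. *)
Lemma gen_tableau_same (j : 'I_r) : is_partition lam ->
  k = j.+1 :> nat -> mu j = mu k -> g j = g k ->
  gen_tableau lam f mu g = gen_tableau lam f mu (incr g k).
Proof.
move=> lam_part kj muj gj; have [b b1 b2] := first_box k_lt.
rewrite /gen_tableau; apply: eq_bigl => T; apply/asboolP/asboolP; rewrite -b1 in b2 *.
  move=> Tt; apply/is_tableau_incr_flag => //; split=> // x xb.
  have [Tsh Tfl Trow Tcol] := Tt.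
  pose d : cell := (j, b.2).
  have lkj : lam k <= lam j by apply: lam_part; rewrite kj.
  have /finset.set0Pn[y yd] : T d != finset.set0.
    by rewrite Tsh /in_shape /= b2 b1 muj; lia.
  have := Tcol d b y x; rewrite b1 => /(_ kj erefl yd xb).
  by apply: leq_ltn_trans; have /andP[] := Tfl _ _ yd; rewrite /= gj.
by case/is_tableau_incr_flag.
Qed.

Hypothesis above : forall j : 'I_r, k = j.+1 :> nat -> mu k < mu j.
Hypothesis below : forall j : 'I_r, j = k.+1 :> nat -> mu k < lam j -> g k < g j.
Hypothesis g_le_f : g k <= f k.

Let g_lt : g k < (fmax f).+1.
Proof. by apply: leq_ltn_trans g_le_f _; rewrite ltnS; apply: leq_bigmax. Qed.

Let a : entry f := Ordinal g_lt.

Definition update T (b : cell) A : gfilling := [ffun c => if c == b then A else T c].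

Lemma update_id T b A : update T b A b = A.
Proof. by rewrite ffunE eqxx. Qed.

Lemma update_neq T b A c : c != b -> update T b A c = T c.
Proof. by rewrite ffunE => /negbTE ->. Qed.

Lemma update_update T b A A' : update (update T b A) b A' = update T b A'.
Proof. by apply/ffunP => c; rewrite !ffunE; case: eqP. Qed.

Lemma update_same T b : update T b (T b) = T.
Proof. by apply/ffunP => c; rewrite !ffunE; case: eqP => [->|]. Qed.

Lemma weight_update T b A w : weight A = (w * weight (T b))%R ->
  (\prod_c weight (update T b A c) = w * \prod_c weight (T c))%R.
Proof.
move=> wA; rewrite (bigD1 b) //= [in RHS](bigD1 b) //= update_id wA -mulrA.
by congr (_ * (_ * _))%R; apply: eq_bigr => c cb; rewrite update_neq.
Qed.

Variable b : cell.
Hypotheses (b1 : b.1 = k) (b2 : b.2 = (mu k).+1 :> nat).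

Let in_shape_b : in_shape mu b.
Proof. by rewrite /in_shape b1 b2 ltnS leqnn. Qed.

Let bE : b.2 = (mu b.1).+1 :> nat.
Proof. by rewrite b1. Qed.

Lemma in_shape_incr c : in_shape (incr mu k) c = in_shape mu c && (c != b).
Proof.
rewrite /in_shape /incr; case: eqP => [c1|c1]; last first.
  by rewrite addn0; case: eqP => [cb|_]; [rewrite cb b1 in c1 | rewrite andbT].
have -> : (c == b) = (c.2 == b.2 :> nat).
  apply/eqP/eqP => [->//|c2].
  by apply: cell_eq; rewrite ?c1.
by rewrite b2 c1 addn1; lia.
Qed.

(* The cells to the left of and above [b] are outside of the shape; those to its right
   and below it have entries at least, respectively greater than, [g k]. *)
Lemma is_tableau_insert mu' g' T A : is_tableau mu' g' T ->
  (forall c, in_shape mu' c = in_shape mu c && ((c != b) || (T b != finset.set0))) ->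
  (forall i, g i <= g' i) -> A = a |: T b -> is_tableau mu g (update T b A).
Proof.
move=> Tt sh gg AE; have [Tsh Tfl Trow Tcol] := Tt.
have inA c x : x \in update T b A c -> (c = b /\ x = a) \/ x \in T c.
  rewrite ffunE; case: eqP => [->|_]; last by right.
  by rewrite AE !finset.inE => /orP[/eqP ->|]; [left|right].
have shT c x : x \in T c -> in_shape mu c.
  by move/(in_tableau Tt); rewrite sh => /andP[].
split.
- move=> c; rewrite ffunE; case: (c =P b) => [->|/eqP cb].
    by rewrite in_shape_b AE; apply/finset.set0Pn; exists a; rewrite !finset.inE eqxx.
  by rewrite Tsh sh cb andbT.
- move=> c x /inA[[-> ->]|/Tfl /andP[gx ->]]; first by rewrite b1 /= leqnn g_le_f.
  by rewrite (leq_trans (gg _) gx).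
- move=> c d x y dc1 dc2 /inA[[cb ->]|xc] /inA[[db ->]|yd].
  + by [].
  + rewrite /=; have /andP[+ _] := Tfl _ _ yd; apply: leq_trans.
    by rewrite dc1 cb b1.
  + have := shT _ _ xc; rewrite /in_shape -dc1 db b1; move: dc2; rewrite db b2; lia.
  exact: Trow dc1 dc2 xc yd.
move=> c d x y dc1 dc2 /inA[[cb ->]|xc] /inA[[db ->]|yd].
- by move: dc1; rewrite cb db; lia.
- have /andP[+ _] := Tfl _ _ yd; apply: leq_trans.
  have := shT _ _ yd; rewrite /in_shape dc2 cb b2 => /andP[_ dl].
  rewrite cb b1 in dc1; apply: leq_trans (gg _); exact: below.
- have := shT _ _ xc; rewrite /in_shape -dc2 db b2.
  by rewrite db b1 in dc1; have := above dc1; lia.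
exact: Tcol dc1 dc2 xc yd.
Qed.

(** Shrinking a set keeps all inequalities; only the shape may change. This serves both to empty
    [b], with [mu'] omitting [b], and to delete [a] from a larger set. *)
Lemma is_tableau_remove mu' T A : is_tableau mu g T -> A \subset T b ->
  (forall c, in_shape mu' c = in_shape mu c && ((c != b) || (A != finset.set0))) ->
  is_tableau mu' g (update T b A).
Proof.
move=> [Tsh Tfl Trow Tcol] AT sh.
have sub c x : x \in update T b A c -> x \in T c.
  by rewrite ffunE; case: eqP => [->|//]; apply: (fintype.subsetP AT).
split=> [c|c x /sub|c d x y e1 e2 /sub xc /sub yd|c d x y e1 e2 /sub xc /sub yd].
- rewrite sh ffunE; case: (c =P b) => [->|/eqP cb] /=; first by rewrite in_shape_b.
  by rewrite Tsh andbT.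
- exact: Tfl.
- exact: Trow e1 e2 xc yd.
exact: Tcol e1 e2 xc yd.
Qed.

(** Emptying [b] is a bijection onto the tableaux of the shape without [b], and loses the weight of
    [[set a]]. *)
Lemma tableau_only_first :
  (\sum_(T : gfilling | `[< is_tableau mu g T >] && (T b == [set a])) \prod_c weight (T c) =
   x_ (g k) * gen_tableau lam f (incr mu k) g)%R.
Proof.
rewrite (reindex_onto (fun T => update T b [set a])
                      (fun T => update T b finset.set0)) /=; last first.
  by move=> T /andP[_ /eqP Tb]; rewrite update_update -Tb update_same.
rewrite /gen_tableau mulr_sumr; apply: eq_big => [T|T].
  rewrite update_id eqxx andbT update_update.
  apply/andP/asboolP => [[/asboolP Tt /eqP TE]|Tt].
    rewrite -TE -(update_update T b [set a]).
    apply: is_tableau_remove Tt _ _; first exact: finset.sub0set.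
    by move=> c; rewrite eqxx orbF in_shape_incr.
  have Tb : T b = finset.set0.
    by apply: is_tableau_out Tt _; rewrite in_shape_incr eqxx andbF.
  split; last by rewrite -Tb update_same.
  apply/asboolP; apply: is_tableau_insert Tt _ _ _ => //.
    by move=> c; rewrite in_shape_incr Tb eqxx orbF.
  by rewrite Tb finset.setU0.
move=> /andP[/andP[/asboolP _ _] /eqP TE].
rewrite (@weight_update _ _ _ (x_ (g k))) // -TE update_update update_id.
by rewrite weight0 weight1 mulr1.
Qed.

(** Deleting [a] from [b] leaves a nonempty set of entries above [g k], so the raised flag holds;
    inserting it back costs one variable and, as an additional entry, one [beta]. *)
Lemma tableau_first_and_more :
  (\sum_(T : gfilling | `[< is_tableau mu g T >] && ((a \in T b) && (T b != [set a])))
     \prod_c weight (T c) =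
   beta * x_ (g k) * gen_tableau lam f mu (incr g k))%R.
Proof.
have TbE T : is_tableau mu (incr g k) T -> T b != finset.set0 /\ a \notin T b.
  move=> [Tsh Tfl _ _]; split; first by rewrite Tsh.
  by apply/negP => /Tfl; rewrite b1 incr_id ltnn.
rewrite (reindex_onto (fun T => update T b (a |: T b))
                      (fun T => update T b (T b :\ a))) /=; last first.
  move=> T /andP[_ /andP[aT _]].
  by rewrite update_update update_id finset.setD1K // update_same.
rewrite /gen_tableau mulr_sumr; apply: eq_big => [T|T].
  rewrite update_update !update_id finset.setU11 /=.
  apply/andP/asboolP => [[/andP[/asboolP Tt aT] /eqP TE]|Tt].
    have aTb : a \notin T b by rewrite -TE update_id !finset.inE eqxx.
    have Tb0 : T b != finset.set0.
      by apply: contra_neq aT => ->; rewrite finset.setU0.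
    rewrite -b1; apply/(is_tableau_incr_flag g T bE).
    have Tt' : is_tableau mu g T.
      rewrite -TE -(update_update T b (a |: T b)).
      apply: is_tableau_remove Tt _ _; first by rewrite update_id finset.subsetDl.
      by move=> c; rewrite finset.setU1K // Tb0 orbT andbT.
    split=> // x xb; have [_ /(_ b x xb)/andP[gx _] _ _] := Tt'.
    rewrite ltn_neqAle gx andbT; apply: contraNneq aTb => ax.
    by rewrite (_ : a = x) //; apply: val_inj; rewrite /= -b1.
  have [Tb0 aTb] := TbE _ Tt.
  split; last by rewrite finset.setU1K // update_same.
  apply/andP; split.
    apply/asboolP; apply: is_tableau_insert Tt _ _ _ => //.
      by move=> c; rewrite Tb0 orbT andbT.
    by move=> i; rewrite /incr leq_addr.
  apply: contraNneq aTb => aE; have /finset.set0Pn[x xb] := Tb0.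
  have : x \in a |: T b by rewrite finset.inE xb orbT.
  by rewrite aE finset.inE => /eqP <-.
rewrite update_id => /andP[/andP[_ /andP[_ aT]] /eqP TE].
have aTb : a \notin T b by rewrite -TE update_id !finset.inE eqxx.
have Tb0 : T b != finset.set0 by apply: contra_neq aT => ->; rewrite finset.setU0.
by rewrite (@weight_update _ _ _ (beta * x_ (g k))) // weightU1.
Qed.

Lemma gen_tableau_step :
  (gen_tableau lam f mu g = x_ (g k) * gen_tableau lam f (incr mu k) g +
    (1 + beta * x_ (g k)) * gen_tableau lam f mu (incr g k))%R.
Proof.
(* In [1 + beta * x_ (g k)], the summand 1 accounts for [b] without [a], the other one for [a] and
   more. *)
rewrite mulrDl mul1r -tableau_only_first -tableau_first_and_more.
rewrite {1}/gen_tableau (bigID (fun T : gfilling => a \in T b)) /=.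
rewrite (bigID (fun T : gfilling => T b == [set a])) /= -addrA; congr (_ + _)%R.
  by apply: eq_bigl => T; case: eqP => [->|]; rewrite ?andbF // !andbT finset.inE eqxx andbT.
rewrite addrC; congr (_ + _)%R; last by apply: eq_bigl => T; rewrite andbA.
apply: eq_bigl => T; apply/andP/asboolP; rewrite -[in incr _ _]b1.
  move=> [/asboolP Tt aT]; apply/(is_tableau_incr_flag g T bE); split=> // x xb.
  have [_ /(_ b x xb)/andP[gx _] _ _] := Tt.
  rewrite ltn_neqAle gx andbT; apply: contraNneq aT => ax.
  by rewrite (_ : a = x) //; apply: val_inj; rewrite /= -b1.
move=> /(is_tableau_incr_flag g T bE)[Tt aT]; split; first exact/asboolP.
by apply/negP => /aT; rewrite b1 ltnn.
Qed.

End Step.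
End Recurrences.

(** * Induction along the common recursion *)

Lemma det_jt_tableau r (lam f mu g : 'I_r -> nat) :
  is_partition lam -> is_partition mu -> (forall i, mu i <= lam i) ->
  is_flagging lam mu f g -> (\det (jt_mx lam f mu g))%R = gen_tableau lam f mu g.
Proof.
move=> lam_part.
(* The measure is the number of boxes plus the distances of the lower flags to [(fmax f).+1]:
   raising [mu k] lowers the first sum, raising [g k] the second. *)
have [n] := ubnP (\sum_(i < r) (lam i - mu i) + \sum_(i < r) ((fmax f).+1 - g i)).
elim: n mu g => // n IHn mu g /ltnSE len mu_part mul fl.
have [/existsP[i0 i0P]|/existsPn empty] := boolP [exists i, mu i < lam i]; last first.
  have mulE i : mu i = lam i by apply/eqP; rewrite eqn_leq mul leqNgt empty.
  by rewrite det_jt_empty // gen_tableau_empty.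
(* [k0] attains the least lower flag of the nonempty rows and [k] is the last row to do so; nonempty
   rows after [k] thus have strictly larger flags. *)
have [k0 k0P k0min] := arg_minnP (P := fun i => mu i < lam i) g i0P.
have k00 : (mu k0 < lam k0) && (g k0 == g k0) by rewrite k0P /=.
have [k /andP[kP /eqP gk] kmax] :=
  arg_maxnP (P := fun i => (mu i < lam i) && (g i == g k0)) (fun i : 'I_r => i : nat) k00.
have gmin i : mu i < lam i -> g k <= g i by rewrite gk; apply: k0min.
have klast i : mu i < lam i -> k < i -> g k < g i.
  move=> iP ki; rewrite ltn_neqAle gmin // andbT; apply/eqP => gki.
  have ik : i <= k by apply: kmax; rewrite iP -gki gk eqxx.
  by rewrite leqNgt ki in ik.
have [/existsP[i1 i1P]|/existsPn fge] := boolP [exists i, (mu i < lam i) && (f i < g k)].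
  have [i /andP[iP fi] imin] := arg_minnP (P := fun i => (mu i < lam i) && (f i < g k)) f i1P.
  (* [f i] lies below the lower flag of every nonempty row, in particular of row [i] itself, which
     admits no entry. *)
  rewrite (det_jt_eq0 (i := i)) // => [|j jP]; last exact: leq_trans fi (gmin _ jP).
  by rewrite (gen_tableau_eq0 iP) //; apply: leq_trans fi (gmin _ iP).
have f_ge i : mu i < lam i -> g k <= f i.
  by move=> iP; have := fge i; rewrite iP -leqNgt.
have below (j : 'I_r) : j = k.+1 :> nat -> mu k < lam j -> g k < g j.
  move=> jk mj; apply: klast; last by rewrite jk.
  by apply: leq_ltn_trans mj; apply: mu_part; rewrite jk.
have gfk : g k <= fmax f by apply: leq_trans (f_ge _ kP) _; apply: leq_bigmax.
(* Only the comparison of row [k] with the next row could fail, and there [below] is strict. *)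
have fl_g : is_flagging lam mu f (incr g k).
  move=> i j ij mi; have [gij ->] := fl _ _ ij mi; split=> //; rewrite /incr.
  have [ik|ik] := eqVneq i k; last by rewrite addn0; apply: leq_trans gij (leq_addr _ _).
  by rewrite ik addn1 (leq_trans (below j _ _)) -?ik ?leq_addr.
have IHg : (\det (jt_mx lam f mu (incr g k)) = gen_tableau lam f mu (incr g k))%R.
  apply: IHn => //; apply: leq_trans len; rewrite -addnS leq_add2l.
  rewrite (bigD1 k) //= [X in _ < X](bigD1 k) //= incr_id -addSn.
  apply: leq_add; first by rewrite subSS subSn.
  by apply: leq_sum => i ik; rewrite incr_neq.
(* In the first case [incr mu k] is not a partition. *)
have [/existsP[j /andP[/eqP kj /eqP muj]]|/existsPn above] :=
  boolP [exists j : 'I_r, (k == j.+1 :> nat) && (mu j == mu k)].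
  have [gjk _] : g j <= g k /\ f j <= f k by apply: fl => //; rewrite muj.
  have jP : mu j < lam j.
    by rewrite muj; apply: leq_trans kP _; apply: lam_part; rewrite kj.
  have gj : g j = g k by apply/eqP; rewrite eqn_leq gjk gmin.
  rewrite (det_jt_same lam_part mu_part mul kP f_ge kj) // IHg.
  by apply/esym; apply: (gen_tableau_same _ kP lam_part kj).
have above' (j : 'I_r) : k = j.+1 :> nat -> mu k < mu j.
  move=> kj; rewrite ltn_neqAle mu_part ?kj // andbT eq_sym.
  by have := above j; rewrite kj eqxx.
have [b b1 b2] := first_box kP.
rewrite (det_jt_step lam_part mu_part mul kP f_ge) IHg.
rewrite (gen_tableau_step kP above' below (f_ge _ kP) b1 b2); congr (_ * _ + _)%R.
have mono i : mu i <= incr mu k i by rewrite leq_addr.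
apply: IHn.
- apply: leq_trans len; rewrite -addSn leq_add2r.
  rewrite (bigD1 k) //= [X in _ < X](bigD1 k) //= incr_id -addSn.
  apply: leq_add; first by rewrite subnS prednK // subn_gt0.
  by apply: leq_sum => i ik; rewrite incr_neq.
- move=> i j ij; rewrite /incr; have [jk|jk] := eqVneq j k; last first.
    by rewrite addn0; apply: leq_trans (mu_part _ _ ij) (leq_addr _ _).
  have [->|ik] := eqVneq i k; first by rewrite jk.
  (* Row [i] is above row [k], so [mu k < mu (k - 1) <= mu i]. *)
  rewrite addn0 addn1 jk.
  have lt_ik : i < k by rewrite ltn_neqAle ik -jk.
  have pr : k.-1 < r by apply: leq_ltn_trans (leq_pred _) (ltn_ord k).
  have kE : k = (Ordinal pr).+1 :> nat by rewrite /= prednK //; apply: leq_ltn_trans lt_ik.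
  apply: leq_trans (above' _ kE) _; apply: mu_part.
  by rewrite -ltnS -kE.
- by move=> i; rewrite /incr; have [->|_] := eqVneq i k; rewrite ?addn1 ?addn0.
(* Raising [mu] only removes adjacencies between rows, hence flagging conditions. *)
move=> i j ij mi; apply: fl => //; exact: leq_ltn_trans mi.
Qed.

Theorem theorem4p7 (r : nat) (lam mu f g : 'I_r -> nat)
    (lam_part : is_partition lam) (lam_gt0 : forall i, 0 < lam i)
    (mu_part : is_partition mu) (mu_le_lam : forall i, mu i <= lam i)
    (f_gt0 : forall i, 0 < f i) (g_gt0 : forall i, 0 < g i)
    (fg_flag : is_flagging lam mu f g) :
  G_det lam mu f g = G_tab lam mu f g.
Proof. by rewrite G_detE G_tabE det_jt_tableau. Qed.
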